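(* Let $X$ be an infinite set. (i) $\operatorname{rank}(\mathcal{PB}_X:\mathcal E_X)=2$. (ii) If $\alpha,\beta\in\mathcal{PB}_X$, then $\mathcal{PB}_X=\langle\mathcal E_X\cup\{\alpha,\beta\}\rangle$ if and only if, after possibly interchanging $\alpha$ and $\beta$, we have $\alpha\in\mathcal G_X^R$, $\beta\in\mathcal G_X^L$ and $\operatorname{codef}(\alpha)=\operatorname{def}(\beta)=|X|$.
   Context: Partial Brauer monoid. Let $X$ be a set and $X'=\{x':x\in X\}$ a disjoint copy of $X$. A Brauer graph is an (undirected) graph with vertex set $X\cup X'$ in which every vertex has degree at most $1$; $\mathcal{PB}_X$ is the set of all of them. Product: let $X''=\{x'':x\in X\}$ be another disjoint copy of $X$; given $\alpha,\beta\in\mathcal{PB}_X$, let $\alpha^\vee$ be $\alpha$ with each vertex $x'$ renamed $x''$, let $\beta^\wedge$ be $\beta$ with each vertex $x\in X$ renamed $x''$, and let $\Pi(\alpha,\beta)$ be the graph on $X\cup X'\cup X''$ with all edges of $\alpha^\vee$ and $\beta^\wedge$. Then $\alpha\beta$ is the graph on $X\cup X'$ with an edge $\{x,y\}$ whenever $x,y\in X\cup X'$ are distinct and lie in the same connected component of $\Pi(\alpha,\beta)$. This makes $\mathcal{PB}_X$ a monoid with identity the graph with edge set $\{\{x,x'\}:x\in X\}$. A transversal of $\alpha$ is an edge $\{x,y'\}$ with $x,y\in X$ (possibly $x=y$). $\operatorname{Dom}(\alpha)$ is the set of $x\in X$ such that $x$ belongs to a transversal of $\alpha$; $\operatorname{Codom}(\alpha)$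 is the set of $x\in X$ such that $x'$ belongs to a transversal; $\operatorname{def}(\alpha)=|X\setminus\operatorname{Dom}(\alpha)|$ and $\operatorname{codef}(\alpha)=|X\setminus\operatorname{Codom}(\alpha)|$. In a monoid $M$, an element $x$ is a left unit if $ax=1$ for some $a\in M$, and a right unit if $xb=1$ for some $b\in M$. $\mathcal G_X^L$ and $\mathcal G_X^R$ denote the submonoids of all left units and all right units of $\mathcal{PB}_X$. $\mathcal E_X$ denotes the subsemigroup of $\mathcal{PB}_X$ generated by all its idempotents. For a subset $U$ of a semigroup $S$, $\langle U\rangle$ is the subsemigroup generated by $U$. For $A\subseteq S$, the relative rank is $\operatorname{rank}(S:A)=\min\{|U| : U\subseteq S,\ S=\langle A\cup U\rangle\}$. *)

(* Defs.v *)
From HB Require Import structures.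
From Stdlib Require Import Relations.
From mathcomp Require Import all_boot.
From mathcomp Require Import boolp classical_sets functions cardinality.

Set Implicit Arguments.
Unset Strict Implicit.
Unset Printing Implicit Defensive.

Local Open Scope classical_set_scope.
Local Open Scope card_scope.
Local Open Scope group_scope.

Section SemigroupNotions.
Variable S : semigroupType.

Definition subsemigroup (A : set S) := forall x y, A x -> A y -> A (x * y).

Definition gen (U : set S) : set S := smallest subsemigroup U.

Definition idempotents : set S := [set e | e * e = e].

Definition idem_gen : set S := gen idempotents.

(* [rank(S : A) = |K|]; the cardinal is given by a set [K], and the minimum is
   spelled out as an attained lower bound. *)
Definition relrank_eq (A : set S) (T : Type) (K : set T) :=
  (exists U : set S, gen (A `|` U) = setT /\ U #= K) /\
  (forall U : set S, gen (A `|` U) = setT -> K #<= U).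

End SemigroupNotions.

Section MonoidNotions.
Variable M : monoidType.

Definition left_units : set M := [set x | exists a, a * x = 1].
Definition right_units : set M := [set x | exists b, x * b = 1].

End MonoidNotions.

Arguments idempotents : clear implicits.
Arguments idem_gen : clear implicits.
Arguments left_units : clear implicits.
Arguments right_units : clear implicits.

(* In [X + X], [inl x] is the vertex x of X and [inr x] the vertex x' of X'. *)
Record brauer (X : Type) := Brauer {
  edge :> X + X -> X + X -> Prop;
  edge_sym : forall u v, edge u v -> edge v u;
  edge_irr : forall u, ~ edge u u;
  edge_deg : forall u, is_subset1 [set v | edge u v]
}.

Lemma brauerP X (a b : brauer X) : (forall u v, a u v <-> b u v) -> a = b.
Proof.
case: a b => [a ? ? ?] [b ? ? ?] /= ab.
have e : a = b by apply/funext => u; apply/funext => v; apply/propext.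
by subst b; congr Brauer; apply: Prop_irrelevance.
Qed.

HB.instance Definition _ (X : Type) := gen_eqMixin (brauer X).
HB.instance Definition _ (X : Type) := gen_choiceMixin (brauer X).

(* The vertices x, x'' and x' of the product graph. *)
Inductive pvertex (X : Type) := Top of X | Mid of X | Bot of X.

Arguments Top {X}. Arguments Mid {X}. Arguments Bot {X}.

Section Product.
Variable X : Type.
Implicit Types (a b c : brauer X) (u v w : X + X) (p q r : pvertex X).

Definition outer u := match u with inl x => Top x | inr x => Bot x end.
Definition upper u := match u with inl x => Top x | inr x => Mid x end.
Definition lower u := match u with inl x => Mid x | inr x => Bot x end.

(* Edges of the product graph: those of the left factor, renamed by [upper],
   and those of the right factor, renamed by [lower]. *)
Definition pedge a b p q :=
  (exists u v, [/\ p = upper u, q = upper v & a u v]) \/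
  (exists u v, [/\ p = lower u, q = lower v & b u v]).

Definition pconn a b := clos_refl_trans (pvertex X) (pedge a b).

Definition mul_edge a b u v := u <> v /\ pconn a b (outer u) (outer v).

Lemma outer_inj : injective outer.
Proof. by move=> [x|x] [y|y] //= [->]. Qed.
Lemma upper_inj : injective upper.
Proof. by move=> [x|x] [y|y] //= [->]. Qed.
Lemma lower_inj : injective lower.
Proof. by move=> [x|x] [y|y] //= [->]. Qed.

Lemma pedge_sym a b p q : pedge a b p q -> pedge a b q p.
Proof.
by case=> -[u [v [-> -> /edge_sym e]]]; [left|right]; exists v, u.
Qed.

Lemma pconn_sym a b p q : pconn a b p q -> pconn a b q p.
Proof.
elim=> [r s /pedge_sym|r|r s t _ h1 _ h2]; first exact: rt_step.
  exact: rt_refl.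
exact: rt_trans h2 h1.
Qed.

End Product.

Section Walk.
Variables (V : Type) (E : bool -> V -> V -> Prop).
Hypothesis E_sym : forall c u v, E c u v -> E c v u.
Hypothesis E_deg : forall c u v w, E c u v -> E c u w -> v = w.

Let conn := clos_refl_trans V (fun u v => exists c, E c u v).
Let extremal u := exists c, forall v, ~ E c u v.
Let step (s t : V * bool) := E s.2 s.1 t.1 /\ t.2 = ~~ s.2.
Let walk := clos_refl_trans (V * bool) step.

Let stuck s := forall t, ~ step s t.

Lemma walk_stuck s t1 t2 :
  walk s t1 -> walk s t2 -> stuck t1 -> stuck t2 -> t1 = t2.
Proof.
move=> w1; have {}w1 := clos_rt_rt1n _ _ _ _ w1.
elim: w1 t2 => [t|r s' t h _ IH] t2 w2; have {w2} := clos_rt_rt1n _ _ _ _ w2.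
  by case=> [//|s' ? h _ /(_ _ h)].
case=> [|s2 {}t2 h2 w2] st1 st2; first by case: (st2 s').
suff e : s' = s2 by apply: IH => //; apply: clos_rt1n_rt; rewrite e.
case: h h2; case: s' {IH} s2 {w2} => [v d] [v2 d2] /= e1 -> [/= e2 ->].
by rewrite (E_deg e1 e2).
Qed.

Lemma walk_last s t : walk s t -> s = t \/ exists2 r, walk s r & step r t.
Proof.
move: t; apply: clos_refl_trans_ind_left; first by left.
by move=> r t sr _ rt; right; exists r.
Qed.

Lemma conn_extremal x y z : extremal x -> extremal y -> extremal z ->
  x <> y -> x <> z -> conn x y -> conn x z -> y = z.
Proof.
move=> [c xc] ey ez xy xz cy cz.
have reach v : conn x v -> exists d, walk (x, ~~ c) (v, d).
  move: v; apply: clos_refl_trans_ind_left => [|u w _ [d wd] [e uw]].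
    by exists (~~ c); apply: rt_refl.
  case: (eqVneq e d) => [ed|ed].
    by exists (~~ d); apply: (rt_trans _ _ _ _ _ wd); apply: rt_step; rewrite -ed.
  have {}ed : e = ~~ d by case: e d ed {uw wd} => [] [].
  case: (walk_last wd) => [[xu cd]|[[t d'] wt [/= tu dd']]].
    by case: (xc w); rewrite xu -(negbK c) cd -ed.
  exists d'; rewrite ed dd' negbK in uw.
  by rewrite -(E_deg (E_sym tu) uw).
have stuckP v : x <> v -> extremal v -> conn x v ->
    exists2 d, walk (x, ~~ c) (v, d) & stuck (v, d).
  move=> xv [e ve] /reach[d wd]; exists d => // -[w d'] [/= vw _].
  case: (walk_last wd) => [[]//|[[t d1] _ [/= tv dd]]].
  case: (eqVneq e d) => [ed|ed]; first by apply: (ve w); rewrite ed.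
  apply: (ve t); suff -> : e = d1 by apply: E_sym.
  by case: e d d1 ed dd {ve vw wd tv} => [] [] [].
have [d1 w1 s1] := stuckP y xy ey cy.
have [d2 w2 s2] := stuckP z xz ez cz.
by case: (walk_stuck w1 w2 s1 s2).
Qed.

End Walk.

Section Monoid.
Variable X : Type.
Implicit Types (a b c : brauer X) (u v w : X + X) (p q r : pvertex X).

Lemma mul_edge_sym a b u v : mul_edge a b u v -> mul_edge a b v u.
Proof. by move=> [/nesym ? /pconn_sym]. Qed.

Lemma mul_edge_irr a b u : ~ mul_edge a b u u.
Proof. by case. Qed.

Lemma mul_edge_deg a b u : is_subset1 [set v | mul_edge a b u v].
Proof.
pose E (d : bool) p q := if d
  then exists u v, [/\ p = lower u, q = lower v & b u v]
  else exists u v, [/\ p = upper u, q = upper v & a u v].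
have sE d p q : E d p q -> E d q p.
  by case: d => -[s [t [-> -> /edge_sym]]]; exists t, s.
have dE d p q r : E d p q -> E d p r -> q = r.
  case: d => -[s [t [-> -> st]]] [s' [t' [+ -> st']]].
    by move=> /lower_inj es; rewrite -es in st'; rewrite (edge_deg st st').
  by move=> /upper_inj es; rewrite -es in st'; rewrite (edge_deg st st').
have cE p q : pconn a b p q ->
    clos_refl_trans _ (fun p q => exists d, E d p q) p q.
  elim=> [{}p {}q [h|h]|{}p|{}p {}q r _ pq _ qr].
  - by apply: rt_step; exists false.
  - by apply: rt_step; exists true.
  - exact: rt_refl.
  - exact: rt_trans pq qr.
have xE s : exists d, forall q, ~ E d (outer s) q.
  case: s => s; [exists true|exists false];
  by move=> q [[t|t] [t' []]].
move=> v w [uv cv] [uw cw]; apply: outer_inj.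
apply: (conn_extremal sE dE (xE u) (xE v) (xE w)); try exact: cE.
- by move=> /outer_inj.
- by move=> /outer_inj.
Qed.

Definition mul_brauer a b : brauer X :=
  Brauer (@mul_edge_sym a b) (@mul_edge_irr a b) (@mul_edge_deg a b).

Definition one_edge u v :=
  match u, v with
  | inl x, inr y | inr x, inl y => x = y
  | _, _ => False
  end.

Lemma one_edge_sym u v : one_edge u v -> one_edge v u.
Proof. by move: u v => [x|x] [y|y] //= ->. Qed.

Lemma one_edge_irr u : ~ one_edge u u.
Proof. by case: u => x /=. Qed.

Lemma one_edge_deg u : is_subset1 [set v | one_edge u v].
Proof. by case: u => x [y|y] [z|z] //= <- <-. Qed.

Definition one_brauer : brauer X :=
  Brauer one_edge_sym one_edge_irr one_edge_deg.

Lemma collapse_conn a b (f : pvertex X -> X + X) c :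
    (forall p q, pedge a b p q -> f p = f q \/ c (f p) (f q)) ->
  forall p q, pconn a b p q -> f p = f q \/ c (f p) (f q).
Proof.
move=> fP p; apply: clos_refl_trans_ind_left => [|q r _ IH /fP qr].
  by left.
case: IH qr => [->//|pq] [<-|qr]; first by right.
by left; apply: (edge_deg (edge_sym pq)).
Qed.

Lemma mul1brauer : left_id one_brauer mul_brauer.
Proof.
move=> a; apply: brauerP => u v; split=> [[uv]|auv]; last first.
  split=> [e|]; first by move: auv; rewrite e; apply: edge_irr.
  have cl w : pconn one_brauer a (outer w) (lower w).
    case: w => x; last exact: rt_refl.
    by apply: rt_step; left; exists (inl x), (inr x).
  apply: rt_trans (cl u) (rt_trans _ _ _ _ _ _ (pconn_sym (cl v))).
  by apply: rt_step; right; exists u, v.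
pose f p := match p with Top x | Mid x => inl x | Bot x => inr x end.
have fo w : f (outer w) = w by case: w.
have fl w : f (lower w) = w by case: w.
move/(@collapse_conn _ _ f a); rewrite !fo => -[||//] // p q.
case=> -[s [t [-> -> st]]]; last by rewrite !fl; right.
by left; move: s t st => [x|x] [y|y] //= ->.
Qed.

Lemma mulbrauer1 : right_id one_brauer mul_brauer.
Proof.
move=> a; apply: brauerP => u v; split=> [[uv]|auv]; last first.
  split=> [e|]; first by move: auv; rewrite e; apply: edge_irr.
  have cu w : pconn a one_brauer (outer w) (upper w).
    case: w => x; first exact: rt_refl.
    by apply: rt_step; right; exists (inr x), (inl x).
  apply: rt_trans (cu u) (rt_trans _ _ _ _ _ _ (pconn_sym (cu v))).
  by apply: rt_step; left; exists u, v.
pose f p := match p with Top x => inl x | Mid x | Bot x => inr x end.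
have fo w : f (outer w) = w by case: w.
have fu w : f (upper w) = w by case: w.
move/(@collapse_conn _ _ f a); rewrite !fo => -[||//] // p q.
case=> -[s [t [-> -> st]]]; first by rewrite !fu; right.
by left; move: s t st => [x|x] [y|y] //= ->.
Qed.

(* Associativity: both bracketings describe connectivity in the graph on four
   layers obtained by stacking three Brauer graphs. *)
Inductive tvertex := T1 of X | T2 of X | T3 of X | T4 of X.

Let la u := match u with inl x => T1 x | inr x => T2 x end.
Let lb u := match u with inl x => T2 x | inr x => T3 x end.
Let lc u := match u with inl x => T3 x | inr x => T4 x end.
Let lo u := match u with inl x => T1 x | inr x => T4 x end.

Let ledge (l : X + X -> tvertex) (a : brauer X) s t :=
  exists u v, [/\ s = l u, t = l v & a u v].

Let tconn a b c := clos_refl_trans tvertex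
  (fun s t => [\/ ledge la a s t, ledge lb b s t | ledge lc c s t]).

Let emb1 p := match p with Top x => T1 x | Mid x => T2 x | Bot x => T3 x end.
Let emb2 p := match p with Top x => T1 x | Mid x => T3 x | Bot x => T4 x end.
Let emb3 p := match p with Top x => T2 x | Mid x => T3 x | Bot x => T4 x end.
Let emb4 p := match p with Top x => T1 x | Mid x => T2 x | Bot x => T4 x end.

Let emb_conn a b (e : pvertex X -> tvertex) (R : tvertex -> tvertex -> Prop) :
    (forall u v, a u v -> clos_refl_trans _ R (e (upper u)) (e (upper v))) ->
    (forall u v, b u v -> clos_refl_trans _ R (e (lower u)) (e (lower v))) ->
  forall p q, pconn a b p q -> clos_refl_trans _ R (e p) (e q).
Proof.
move=> ha hb p q; elim=> [{}p {}q|*|r s t _ IH1 _ IH2].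
- by case=> -[u [v [-> -> ]]]; [apply: ha|apply: hb].
- exact: rt_refl.
- exact: rt_trans IH1 IH2.
Qed.

Let mulL_conn a b c u v :
  pconn (mul_brauer a b) c (outer u) (outer v) <-> tconn a b c (lo u) (lo v).
Proof.
have eab p q : pconn a b p q -> tconn a b c (emb1 p) (emb1 q).
  apply: emb_conn => s t st; apply: rt_step.
    by apply: Or31; exists s, t; split=> //; [case: s {st}|case: t {st}].
  by apply: Or32; exists s, t; split=> //; [case: s {st}|case: t {st}].
split.
  suff h p q : pconn (mul_brauer a b) c p q -> tconn a b c (emb2 p) (emb2 q).
    by move=> /h; move: u v => [x|x] [y|y].
  apply: emb_conn => s t; first by case=> _ /eab; move: s t => [x|x] [y|y].
  move=> st; apply: rt_step; apply: Or33; exists s, t.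
  by split=> //; [case: s {st}|case: t {st}].
pose ab := mul_brauer a b.
have ab_conn s t : pconn a b (outer s) (outer t) ->
    pconn ab c (upper s) (upper t).
  move=> st; have [->|ne] := pselect (s = t); first exact: rt_refl.
  by apply: rt_step; left; exists s, t.
pose P t := match t with
  | T1 x => pconn ab c (outer u) (Top x)
  | T3 x => pconn ab c (outer u) (Mid x)
  | T4 x => pconn ab c (outer u) (Bot x)
  | T2 x => exists2 w, pconn ab c (outer u) (upper w)
                     & pconn a b (outer w) (Mid x)
  end.
pose Q p := exists2 w, pconn ab c (outer u) (upper w) & pconn a b (outer w) p.
have PQ p : P (emb1 p) <-> Q p.
  case: p => x //=; split.
  - by move=> h; exists (inl x) => //; apply: rt_refl.
  - by case=> w h /(ab_conn _ (inl x)); apply: rt_trans h.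
  - by move=> h; exists (inr x) => //; apply: rt_refl.
  - by case=> w h /(ab_conn _ (inr x)); apply: rt_trans h.
have Pab p q : pedge a b p q -> P (emb1 p) -> P (emb1 q).
  move=> pq /PQ[w h1 h2]; apply/PQ; exists w => //.
  exact: rt_trans h2 (rt_step _ _ _ _ pq).
suff h t : tconn a b c (lo u) t -> P t by move=> /h; case: v => x.
move: t; apply: clos_refl_trans_ind_left => [|s r _ Ps sr].
  have Po w : pconn ab c (outer u) (outer w) -> P (lo w) by case: w.
  by apply: Po; apply: rt_refl.
case: sr Ps => -[s' [r' [-> -> sr]]].
- have lE w : la w = emb1 (upper w) by case: w.
  by rewrite !lE; apply: Pab; left; exists s', r'.
- have lE w : lb w = emb1 (lower w) by case: w.
  by rewrite !lE; apply: Pab; right; exists s', r'.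
- have PE w : P (lc w) = pconn ab c (outer u) (lower w) by case: w.
  rewrite !PE => h; apply: rt_trans h _; apply: rt_step.
  by right; exists s', r'.
Qed.

Let mulR_conn a b c u v :
  pconn a (mul_brauer b c) (outer u) (outer v) <-> tconn a b c (lo u) (lo v).
Proof.
have ebc p q : pconn b c p q -> tconn a b c (emb3 p) (emb3 q).
  apply: emb_conn => s t st; apply: rt_step.
    by apply: Or32; exists s, t; split=> //; [case: s {st}|case: t {st}].
  by apply: Or33; exists s, t; split=> //; [case: s {st}|case: t {st}].
pose bc := mul_brauer b c.
split.
  suff h p q : pconn a bc p q -> tconn a b c (emb4 p) (emb4 q).
    by move=> /h; move: u v => [x|x] [y|y].
  apply: emb_conn => s t; last by case=> _ /ebc; move: s t => [x|x] [y|y].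
  move=> st; apply: rt_step; apply: Or31; exists s, t.
  by split=> //; [case: s {st}|case: t {st}].
have bc_conn s t : pconn b c (outer s) (outer t) ->
    pconn a bc (lower s) (lower t).
  move=> st; have [->|ne] := pselect (s = t); first exact: rt_refl.
  by apply: rt_step; right; exists s, t.
pose P t := match t with
  | T1 x => pconn a bc (outer u) (Top x)
  | T2 x => pconn a bc (outer u) (Mid x)
  | T4 x => pconn a bc (outer u) (Bot x)
  | T3 x => exists2 w, pconn a bc (outer u) (lower w)
                     & pconn b c (outer w) (Mid x)
  end.
pose Q p := exists2 w, pconn a bc (outer u) (lower w) & pconn b c (outer w) p.
have PQ p : P (emb3 p) <-> Q p.
  case: p => x //=; split.
  - by move=> h; exists (inl x) => //; apply: rt_refl.
  - by case=> w h /(bc_conn _ (inl x)); apply: rt_trans h.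
  - by move=> h; exists (inr x) => //; apply: rt_refl.
  - by case=> w h /(bc_conn _ (inr x)); apply: rt_trans h.
have Pbc p q : pedge b c p q -> P (emb3 p) -> P (emb3 q).
  move=> pq /PQ[w h1 h2]; apply/PQ; exists w => //.
  exact: rt_trans h2 (rt_step _ _ _ _ pq).
suff h t : tconn a b c (lo u) t -> P t by move=> /h; case: v => x.
move: t; apply: clos_refl_trans_ind_left => [|s r _ Ps sr].
  have Po w : pconn a bc (outer u) (outer w) -> P (lo w) by case: w.
  by apply: Po; apply: rt_refl.
case: sr Ps => -[s' [r' [-> -> sr]]].
- have PE w : P (la w) = pconn a bc (outer u) (upper w) by case: w.
  rewrite !PE => h; apply: rt_trans h _; apply: rt_step.
  by left; exists s', r'.
- have lE w : lb w = emb3 (upper w) by case: w.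
  by rewrite !lE; apply: Pbc; left; exists s', r'.
- have lE w : lc w = emb3 (lower w) by case: w.
  by rewrite !lE; apply: Pbc; right; exists s', r'.
Qed.

Lemma mulbrauerA : associative mul_brauer.
Proof.
move=> a b c; apply: brauerP => u v.
by split=> -[uv h]; split=> //; [apply/mulL_conn/mulR_conn|apply/mulR_conn/mulL_conn].
Qed.

End Monoid.

HB.instance Definition _ (X : Type) :=
  isMonoid.Build (brauer X) (@mulbrauerA X) (@mul1brauer X) (@mulbrauer1 X).

Section Transversals.
Variables (X : Type) (a : brauer X).

Definition Dom : set X := [set x | exists y, a (inl x) (inr y)].
Definition Codom : set X := [set y | exists x, a (inl x) (inr y)].

(* [def(a)] and [codef(a)] are the cardinals of these two sets. *)
Definition Defect : set X := ~` Dom.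
Definition Codefect : set X := ~` Codom.

End Transversals.

(* Main.v *)
Require Import Defs.
From Stdlib Require Import Relations.
From mathcomp Require Import all_boot.
From mathcomp Require Import boolp classical_sets functions cardinality.
From mathcomp Require Import zify.

(** The flip that exchanges X and X' is an involutive anti-automorphism, and the
    right units are the graphs all of whose upper vertices lie on transversals
    ([right_unitsP]): such an a satisfies a * flip a = 1. Dually the left units
    are the graphs with full codomain.

    Generation ([generate_all]). Let a be a right unit with transversals
    x -- (f x)' and b a left unit with transversals g y -- y'. If the injections
    f and g have disjoint ranges and there is a third injection w avoiding both,
    then for every graph c a single idempotent e, the graph [link], satisfies
    a * e * b = c. It copies c along f above and along g below, and a detour
    through w brings the lower copy of each transversal back to the upper one,
    which is exactly what idempotency requires. In general the ranges of f and g
    overlap. But multiplying a on the right by such an e (for c = 1) replaces f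
    by any injection with range disjoint from that of f that leaves room for w;
    since both codef a and def b are |X|, at most two such moves take the range
    of f off that of g.

    Necessity. An idempotent that is a one-sided unit equals 1, and from this a
    generating set must contain a left unit that is not a right unit and a right
    unit that is not a left unit ([strict_generators]); they are distinct, which
    also gives the lower bound on the rank. For the size of codef a, suppose
    codef a < |X| and follow the prefixes of a factorisation of a right unit:
    they are right units, and multiplying by one more factor keeps codef below
    |X|. For the factor a this is subadditivity of codef; the left unit b has
    codef 0; for an idempotent e, the right unit p * e forces def e to be small
    ([Defect_right_factor]), and an idempotent of small def has small codef
    ([Codefect_idem]). This contradicts the existence of right units of codef |X|
    ([big_Codefect]); flipping gives the statement about def b.

    The cardinal arithmetic behind this is that a union of two sets of
    cardinality less than |X| is less than |X|, and that an infinite set contains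
    two disjoint copies of itself; both are derived from Zorn's lemma. *)

Set Implicit Arguments.
Unset Strict Implicit.
Unset Printing Implicit Defensive.

Local Open Scope classical_set_scope.
Local Open Scope card_scope.

(** * Cardinal arithmetic for infinite sets *)

Section Cardinals.
Variable T : Type.
Implicit Types (A B C : set T) (s t : nat -> T).

Lemma card_le_fun U V (A : set U) (B : set V) (f : U -> V) :
  (forall x, A x -> B (f x)) ->
  (forall x y, A x -> A y -> f x = f y -> x = y) -> A #<= B.
Proof.
move=> fAB finj.
have /injfunPex[g] : exists2 f : U -> V, set_fun A B f & set_inj A f.
  by exists f => // x y /set_mem Ax /set_mem Ay; apply: finj.
exact: inj_card_le.
Qed.

(** Starting from the full set, the injection between subtypes given by [#<=] is
    an honest function on the ambient types. *)
Lemma fun_card_le U V (B : set V) : [set: U] #<= B ->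
  exists f : U -> V, injective f /\ forall x, B (f x).
Proof.
move=> /card_leP[f]; exists (fun x => set_val (f (SigSub (in_setT x)))).
split=> [x y|x]; last exact: set_valP.
by move=> /val_inj /(inj (f := f)); rewrite !in_setT => /(_ isT isT) -[].
Qed.

(** |A| + |A| <= |A|: a maximal family of pairwise disjoint sequences in A leaves
    only a finite remainder R. On the range of a sequence s the two copies of s n
    are s (3 n) and s (3 n + 1), and the places of index 2 modulo 3 of one fixed
    sequence s0 are kept for the two copies of R, numbered by c. *)
Lemma doubling A : infinite_set A ->
  exists d : T -> bool -> T, (forall x i, A x -> A (d x i)) /\
    forall x y i j, A x -> A y -> d x i = d y j -> x = y /\ i = j.
Proof.
move=> infA.
pose P (F : set (nat -> T)) := (forall s n, F s -> A (s n)) /\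
  forall s t m n, F s -> F t -> s m = t n -> s = t /\ m = n.
have [F [[FA Finj] Fmax]] : exists F, P F /\ forall G, F `<` G -> ~ P G.
  apply: Zorn_bigcup => C CP Ctot.
  split=> [s n [F CF Fs]|s t m n [F CF Fs] [G CG Gt]].
    by case: (CP F CF) => h _; apply: h.
  case: (Ctot F G CF CG) => [/(_ s Fs) Gs|/(_ t Gt) Ft].
    by case: (CP G CG) => _; apply.
  by case: (CP F CF) => _; apply.
pose R := A `\` [set x | exists s n, F s /\ x = s n].
have finR : finite_set R.
  apply: contrapT => /infiniteP /fun_card_le[s [sinj sR]].
  apply: (Fmax (F `|` [set s])).
    split; first by apply: subsetUl.
    move=> /(_ s (or_intror erefl)) Fs.
    by case: (sR 0%N) => _; apply; exists s, 0%N.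
  split=> [t n [/FA//|->]|t u m n [Ft|->] [Fu|->]]; first by case: (sR n).
  - exact: Finj.
  - by move=> e; case: (sR n) => _ []; exists t, m.
  - by move=> e; case: (sR m) => _ []; exists u, n.
  - by move=> /sinj.
have [s0 Fs0] : F !=set0.
  apply/set0P/eqP => F0; apply: infA; apply: sub_finite_set finR => x Ax.
  by split=> // -[s [n []]]; rewrite F0.
have [c cinj] := countable_injP _ (finite_set_countable finR).
pose d x (i : bool) := match pselect (exists sn, F sn.1 /\ x = sn.1 sn.2) with
  | left h => let sn := sval (cid h) in sn.1 (3 * sn.2 + i)%N
  | right _ => s0 (3 * (2 * c x + i) + 2)%N end.
exists d.
have dP x i : A x -> (exists s n, [/\ F s, x = s n & d x i = s (3 * n + i)%N]) \/
    (R x /\ d x i = s0 (3 * (2 * c x + i) + 2)%N).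
  move=> Ax; rewrite /d; case: pselect => [h|h].
    left; case: (cid h) => -[s n] [/= Fs xs]; exists s, n; split=> //.
  right; split=> //; split=> // -[s [n h']]; apply: h; by exists (s, n).
split=> [x i Ax|x y i j Ax Ay].
  by case: (dP x i Ax) => [[s [n [Fs _ ->]]]|[_ ->]]; apply: FA.
case: (dP x i Ax) => [[s [n [Fs -> ->]]]|[Rx ->]];
  case: (dP y j Ay) => [[t [m [Ft -> ->]]]|[Ry ->]] /Finj [] // e k.
- by subst t; case: i j k => [] [] k; split=> //; try congr (s _); lia.
- lia.
- lia.
- case: i j k => [] [] k; split=> //; try (by lia);
  by apply: cinj; rewrite ?in_setE //; lia.
Qed.

(** A maximal injective partial map from A to B, viewed as its graph, is total or
    surjective. *)
Lemma card_total A B : A #<= B \/ B #<= A.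
Proof.
pose P (G : set (T * T)) := [/\ forall z, G z -> A z.1 /\ B z.2,
  forall z w, G z -> G w -> z.1 = w.1 -> z = w &
  forall z w, G z -> G w -> z.2 = w.2 -> z = w].
have [G [[GAB G1 G2] Gmax]] : exists G, P G /\ forall H, G `<` H -> ~ P H.
  apply: Zorn_bigcup => C CP Ctot; split=> [z [F CF Fs]|z w [F CF Fz] [H CH Hw]|
      z w [F CF Fz] [H CH Hw]].
  - by case: (CP F CF) => h _ _; apply: h.
  - case: (Ctot F H CF CH) => [/(_ _ Fz) Hz|/(_ _ Hw) Fw].
      by case: (CP H CH) => _ h _; apply: h.
    by case: (CP F CF) => _ h _; apply: h.
  - case: (Ctot F H CF CH) => [/(_ _ Fz) Hz|/(_ _ Hw) Fw].
      by case: (CP H CH) => _ _; apply.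
    by case: (CP F CF) => _ _; apply.
have [Afull|nA] := pselect (forall x, A x -> exists y, G (x, y)).
  have /choice[f fP] x : exists y, A x -> G (x, y).
    by have [/Afull[y]|] := pselect (A x); [exists y|exists x].
  left; apply: (@card_le_fun _ _ _ _ f) => [x /fP/GAB[]//|x y /fP Gx /fP Gy e].
  by have [] := G2 _ _ Gx Gy e.
have [Bfull|nB] := pselect (forall y, B y -> exists x, G (x, y)).
  have /choice[f fP] y : exists x, B y -> G (x, y).
    by have [/Bfull[x]|] := pselect (B y); [exists x|exists y].
  right; apply: (@card_le_fun _ _ _ _ f) => [x /fP/GAB[]//|x y /fP Gx /fP Gy e].
  by have [] := G1 _ _ Gx Gy e.
move: nA nB => /existsNP[x /not_implyP[Ax nx]] /existsNP[y /not_implyP[By ny]].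
case: (Gmax (G `|` [set (x, y)])).
  split; first exact: subsetUl.
  by move=> /(_ (x, y) (or_intror erefl)) Gxy; apply: nx; exists y.
split=> [z [/GAB//|->//]|[z1 z2] [w1 w2]|[z1 z2] [w1 w2]] /=.
- move=> [Gz|[-> ->]] [Gw|[-> ->]] // e; first exact: G1.
    by case: nx; exists z2; rewrite -e.
  by case: nx; exists w2; rewrite e.
- move=> [Gz|[-> ->]] [Gw|[-> ->]] // e; first exact: G2.
    by case: ny; exists z1; rewrite -e.
  by case: ny; exists w1; rewrite e.
Qed.

(** Contrapositively, two sets smaller than an infinite C have a union smaller
    than C. By comparability the union embeds in two copies of the larger set,
    which is infinite, so that [doubling] applies to it. *)
Lemma card_le_setU C A B : infinite_set C -> C #<= A `|` B ->
  C #<= A \/ C #<= B.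
Proof.
move=> infC; wlog AB : A B / A #<= B.
  move=> wl; have [AB|BA] := card_total A B; first exact: wl.
  by rewrite setUC => /(wl _ _ BA)[]; [right|left].
move=> CAB; right.
have infB : infinite_set B.
  move=> finB; apply: infC.
  apply: (card_le_finite CAB).
  by rewrite finite_setU; split=> //; apply: card_le_finite AB finB.
apply: card_le_trans CAB _.
have [d [dB dinj]] := doubling infB.
have [f fB finj] : exists2 f : T -> T, forall x, A x -> B (f x) &
    {in A &, injective f}.
  have /fun_card_le[f [finj fB]] : [set: A] #<= B.
    by rewrite (card_le_eql (card_setT A)).
  exists (fun x =>
      if pselect (A x) is left Ax then f (SigSub (mem_set Ax)) else x).
    by move=> x Ax; case: pselect.
  move=> x y; rewrite !in_setE => Ax Ay; case: pselect => // Ax'.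
  by case: pselect => // Ay' /finj [].
pose h z := if pselect (B z) then d z false else d (f z) true.
have hP z : (A `|` B) z -> B z /\ h z = d z false \/ A z /\ h z = d (f z) true.
  by rewrite /h; case: pselect => [Bz _|nBz [Az|//]]; [left|right].
apply: (@card_le_fun _ _ _ _ h) => [z /hP[[Bz ->]|[Az ->]]|x y].
- exact: dB.
- by apply: dB; apply: fB.
case/hP => -[Hx ->] /hP[] [Hy ->] /dinj []; rewrite //; try exact: fB.
by move=> e _; apply: finj; rewrite ?in_setE.
Qed.

Lemma set0_small : infinite_set [set: T] -> ~ ([set: T] #<= @set0 T).
Proof. by move=> infT /card_le_finite/(_ (finite_set0 _)). Qed.

End Cardinals.
Section TwoCopies.
Variable X : Type.
Hypothesis infX : infinite_set [set: X].

Lemma two_copies (C : set X) : [set: X] #<= C ->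
  exists f w : X -> X, [/\ injective f, injective w, forall x, C (f x),
    forall x, C (w x) & forall x y, f x <> w y].
Proof.
move=> /fun_card_le[j [jinj jC]]; have [d [_ dinj]] := doubling infX.
exists (fun x => j (d x false)), (fun x => j (d x true)).
split=> // [x y /jinj /dinj[]//|x y /jinj /dinj[]//|x y /jinj /dinj[]//].
Qed.

End TwoCopies.

(** * The flip and the product of Brauer graphs *)

Section Brauer.
Local Open Scope group_scope.
Variable X : Type.
Implicit Types (a b c e p : brauer X) (u v : X + X) (f g w : X -> X).

Definition swap u : X + X := match u with inl x => inr x | inr x => inl x end.

Lemma swapK : involutive swap. Proof. by case. Qed.

Lemma flip_sym a u v : a (swap u) (swap v) -> a (swap v) (swap u).
Proof. exact: edge_sym. Qed.

Lemma flip_irr a u : ~ a (swap u) (swap u).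
Proof. exact: edge_irr. Qed.

Lemma flip_deg a u : is_subset1 [set v | a (swap u) (swap v)].
Proof. by move=> v1 v2 /edge_deg/[apply]/(can_inj swapK). Qed.

Definition flip a : brauer X := Brauer (@flip_sym a) (@flip_irr a) (@flip_deg a).

Lemma flipK : involutive flip.
Proof. by move=> a; apply: brauerP => u v /=; rewrite !swapK. Qed.

Definition pswap (q : pvertex X) :=
  match q with Top x => Bot x | Mid x => Mid x | Bot x => Top x end.

Lemma pconn_flip a b q r :
  pconn a b q r -> pconn (flip b) (flip a) (pswap q) (pswap r).
Proof.
have up u : pswap (upper u) = lower (swap u) by case: u.
have lo u : pswap (lower u) = upper (swap u) by case: u.
elim=> [s t|s|s t z _ st _ tz]; [|exact: rt_refl|exact: rt_trans st tz].
case=> -[u [v [-> -> uv]]]; apply: rt_step; rewrite ?up ?lo; [right|left];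
  by exists (swap u), (swap v); rewrite /= !swapK.
Qed.

Lemma flipM a b : flip (a * b) = flip b * flip a.
Proof.
have ou u : pswap (outer u) = outer (swap u) by case: u.
apply: brauerP => u v; split=> -[uv /pconn_flip].
  rewrite !ou !swapK => h; split=> // e; by apply: uv; rewrite e.
rewrite !ou !flipK => h; split=> // /(can_inj swapK); exact: uv.
Qed.

Lemma flip1 : flip 1 = 1.
Proof. by apply: brauerP => -[x|x] [y|y] /=. Qed.

Lemma Dom_flip a : Dom (flip a) = Codom a.
Proof. by apply/seteqP; split=> x [y /edge_sym]; exists y. Qed.

Lemma Codom_flip a : Codom (flip a) = Dom a.
Proof. by rewrite -Dom_flip flipK. Qed.

Lemma pconn_upper a b u v : a u v -> pconn a b (upper u) (upper v).
Proof. by move=> uv; apply: rt_step; left; exists u, v. Qed.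

Lemma pconn_lower a b u v : b u v -> pconn a b (lower u) (lower v).
Proof. by move=> uv; apply: rt_step; right; exists u, v. Qed.

Lemma mul_path a b u v (q : pvertex X) : u <> v ->
  pconn a b (outer u) q -> pconn a b q (outer v) -> (a * b)%g u v.
Proof. by move=> uv uq qv; split=> //; apply: rt_trans uq qv. Qed.

(** To bound a product from above, label the vertices of the product graph by
    vertices of c so that every edge is contracted or sent to an edge of c; the
    label of a vertex on no relevant path may be an arbitrary constant. *)
Lemma mul_collapse a b c (h : pvertex X -> X + X) :
    (forall u v, a u v ->
       h (upper u) = h (upper v) \/ c (h (upper u)) (h (upper v))) ->
    (forall u v, b u v ->
       h (lower u) = h (lower v) \/ c (h (lower u)) (h (lower v))) ->
  forall u v, (a * b)%g u v ->
    h (outer u) = h (outer v) \/ c (h (outer u)) (h (outer v)).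
Proof.
by move=> ha hb u v [_]; apply: collapse_conn => q r;
  case=> -[u1 [v1 [-> ->]]]; [apply: ha|apply: hb].
Qed.

(** Non-connectivity in the product graph is certified by a set of vertices that
    is closed under its edges. *)
Lemma mul_closed a b (P : pvertex X -> Prop) :
    (forall u v, a u v -> P (upper u) -> P (upper v)) ->
    (forall u v, b u v -> P (lower u) -> P (lower v)) ->
  forall u v, (a * b)%g u v -> P (outer u) -> P (outer v).
Proof.
move=> ha hb u v [_ uv] Pu.
move: uv; move: (outer v); apply: clos_refl_trans_ind_left => // q r _ Pq.
by case=> -[u1 [v1 [e1 e2 uv1]]]; rewrite e2; rewrite e1 in Pq;
  [apply: ha Pq|apply: hb Pq].
Qed.

(** * One-sided units *)

(** If x is not in [Dom a] then the component of the upper vertex x in the product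
    graph consists of x and its partner in an upper edge of a, if any. *)
Lemma sub_Dom_mul a b : Dom (a * b) `<=` Dom a.
Proof.
move=> x [z xz]; apply: contrapT => nx.
pose P (q : pvertex X) := q = Top x \/ exists2 y, q = Top y & a (inl x) (inl y).
have : P (outer (inr z)); last by case=> [|[]].
apply: (@mul_closed _ _ P _ _ _ _ xz); last by left.
  move=> [y|y] v yv; last by case=> [|[]].
  case=> [[ey]|[y' [ey] xy]].
    move: yv; rewrite ey; case: v => [t|t] /= h; first by right; exists t.
    by case: nx; exists t.
  by left; rewrite ey in yv; rewrite -(edge_deg (edge_sym xy) yv).
by move=> [y|y] v _ [|[]].
Qed.

Lemma Dom1 : Dom (1 : brauer X) = setT.
Proof. by apply/seteqP; split=> // x _; exists x. Qed.

(** On right units the transversals form a function f; the range of f is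
    [Codom a]. *)
Definition sends a f := forall x, a (inl x) (inr (f x)).

Lemma sends_inj a f : sends a f -> injective f.
Proof.
move=> af x y e; move: (af x) (af y); rewrite e => /edge_sym h /edge_sym h'.
by have [] := edge_deg h h'.
Qed.

Lemma DomTP a : Dom a = setT <-> exists f, sends a f.
Proof.
split=> [DT|[f af]]; last by apply/seteqP; split=> // x _; exists (f x).
have /choice[f af] x : exists y, a (inl x) (inr y).
  by have : Dom a x by rewrite DT.
by exists f.
Qed.

Lemma sends_edge a f u v : sends a f -> a u v ->
  [\/ exists x, u = inl x /\ v = inr (f x),
      exists x, u = inr (f x) /\ v = inl x |
      exists y z, [/\ u = inr y, v = inr z, ~ range f y & ~ range f z]].
Proof.
move=> af; case: u v => [x|y] [z|z] uv.
- by have := edge_deg uv (af x).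
- by apply: Or31; exists x; rewrite (edge_deg uv (af x)).
- by apply: Or32; exists z; rewrite (edge_deg (edge_sym uv) (af z)).
- apply: Or33; exists y, z; split=> // -[x _ e]; move: (af x); rewrite e.
    by move=> /edge_sym/(edge_deg uv).
  by move=> /edge_sym/(edge_deg (edge_sym uv)).
Qed.

(** The label r x at the vertex f x, and the default d off the range of f; used
    to label middle vertices in [mul_collapse]. *)
Definition along f (r : X -> X + X) (d : X + X) z : X + X :=
  if pselect (range f z) is left E then r (sval (cid2 E)) else d.

Lemma alongE f r d x : injective f -> along f r d (f x) = r x.
Proof.
move=> finj; rewrite /along; case: pselect => [E|[]]; last by exists x.
by case: (cid2 E) => y /= _ /finj ->.
Qed.

Lemma along_out f r d z : ~ range f z -> along f r d z = d.
Proof. by rewrite /along; case: pselect. Qed.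

Lemma mul_flip a : Dom a = setT -> a * flip a = 1.
Proof.
move=> /DomTP[f af]; have finj := sends_inj af.
apply: brauerP => u v; split; last first.
  have path x : pconn a (flip a) (Top x) (Bot x).
    apply: rt_trans (pconn_upper _ (af x)) _.
    apply: (@pconn_lower _ (flip a) (inl (f x)) (inr x)).
    exact: edge_sym (af x).
  by case: u v => [x|x] [y|y] //= ->; split=> //; [|apply: pconn_sym];
    apply: path.
pose h (q : pvertex X) := match q with
  (* The vertices off the range of f carry only hooks, so any constant serves. *)
  | Top x => inl x | Bot x => inr x | Mid z => along f inl u z end.
have ho u1 : h (outer u1) = u1 by case: u1.
move=> uv; have := @mul_collapse a (flip a) 1 h _ _ u v uv.
rewrite !ho => -[||uv_eq|//]; last 1 first.
- by case: uv => /(_ uv_eq).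
- move=> u1 v1 /(sends_edge af).
  by case=> [[x [-> ->]]|[x [-> ->]]|[y [z [-> -> ny nz]]]] /=;
    left; rewrite ?alongE ?along_out.
- move=> u1 v1 /(sends_edge af) uv1; rewrite -(swapK u1) -(swapK v1).
  by case: uv1 => [[x [-> ->]]|[x [-> ->]]|[y [z [-> -> ny nz]]]] /=;
    rewrite ?alongE ?along_out //; [right|right|left].
Qed.

Lemma right_unitsP a : right_units (brauer X) a <-> Dom a = setT.
Proof.
split=> [[b ab]|/mul_flip]; last by exists (flip a).
by apply/seteqP; split=> // x _; apply: (@sub_Dom_mul a b); rewrite ab Dom1.
Qed.

Lemma left_right_flip a :
  left_units (brauer X) a <-> right_units (brauer X) (flip a).
Proof.
split=> -[b e]; exists (flip b); first by rewrite -flipM e flip1.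
by rewrite -(flipK a) -flipM e flip1.
Qed.

Lemma left_unitsP a : left_units (brauer X) a <-> Codom a = setT.
Proof. by rewrite left_right_flip right_unitsP Dom_flip. Qed.

(** * The linking idempotent *)

Section Link.
Variables (f g w : X -> X) (c : brauer X).
Hypotheses (finj : injective f) (ginj : injective g) (winj : injective w).
Hypotheses (fg : forall x y, f x <> g y) (fw : forall x y, f x <> w y)
  (gw : forall x y, g x <> w y).

Definition place u : X + X :=
  match u with inl x => inl (f x) | inr y => inr (g y) end.

(** For a transversal x -- y' of c, idempotency needs a path from the middle
    vertex g y to the middle vertex f x. The edge g y -- w y above and the edge
    (w y)' -- (f x)' below provide it. *)
Inductive half_link : X + X -> X + X -> Prop :=
| HalfPlace u v of c u v : half_link (place u) (place v)
| HalfUpper y : half_link (inl (g y)) (inl (w y))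
| HalfLower x y of c (inl x) (inr y) : half_link (inr (w y)) (inr (f x)).

Definition link_edge u v := half_link u v \/ half_link v u.

Lemma place_inj : injective place.
Proof. by move=> [x|x] [y|y] //= [] => [/finj|/ginj] ->. Qed.

Lemma link_sym u v : link_edge u v -> link_edge v u.
Proof. by case; [right|left]. Qed.

Lemma link_irr u : ~ link_edge u u.
Proof.
suff h v : half_link u v -> u <> v by move=> [] /h.
case=> [? ? uv /place_inj e|y [/gw]|x y _ [/esym/fw]] //.
by move: uv; rewrite e => /edge_irr.
Qed.

Lemma link_deg u : is_subset1 [set v | link_edge u v].
Proof.
have gf x y : g x <> f y by move/esym/fg.
have wf x y : w x <> f y by move/esym/fw.
have wg x y : w x <> g y by move/esym/gw.
have hh u1 v1 u2 v2 : half_link u1 v1 -> half_link u2 v2 ->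
  [/\ u1 = u2 -> v1 = v2, v1 = v2 -> u1 = u2 & u1 = v2 -> v1 = u2].
  case=> [p q pq|y|x y xy]; case=> [p' q' pq'|y'|x' y' xy'].
  - split=> /place_inj e; congr place.
    + by rewrite -e in pq'; apply: edge_deg pq pq'.
    + by rewrite -e in pq'; apply: edge_deg (edge_sym pq) (edge_sym pq').
    + by rewrite -e in pq'; apply: edge_deg pq (edge_sym pq').
  - by case: p q pq => [x|x] [z|z] _; split=> //= -[] //;
      do ?[move/fg|move/gf|move/fw|move/wf|move/gw|move/wg].
  - by case: p q pq => [x|x] [z|z] _; split=> //= -[] //;
      do ?[move/fg|move/gf|move/fw|move/wf|move/gw|move/wg].
  - by case: p' q' pq' => [x|x] [z|z] _; split=> //= -[] //;
      do ?[move/fg|move/gf|move/fw|move/wf|move/gw|move/wg].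
  - by split=> //= -[]; [move/ginj->|move/winj->|move/gw].
  - by split.
  - by case: p' q' pq' => [x1|x1] [z|z] _; split=> //= -[] //;
      do ?[move/fg|move/gf|move/fw|move/wf|move/gw|move/wg].
  - by split.
  - split=> -[].
    + move/winj=> e; rewrite -e in xy'.
      by have [->] := edge_deg (edge_sym xy) (edge_sym xy').
    + by move/finj=> e; rewrite -e in xy'; have [->] := edge_deg xy xy'.
    + by move/wf.
move=> v1 v2 [h1|h1] [h2|h2]; have [A B C] := hh _ _ _ _ h1 h2.
- exact: A.
- exact: C.
- by have [_ _ /(_ erefl)] := hh _ _ _ _ h2 h1.
- exact: B.
Qed.

Definition link : brauer X := Brauer link_sym link_irr link_deg.

Lemma link_place u v : c u v -> link (place u) (place v).
Proof. by move=> uv; left; apply: HalfPlace. Qed.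

Lemma link_upper y : link (inl (g y)) (inl (w y)).
Proof. by left; apply: HalfUpper. Qed.

Lemma link_lower x y : c (inl x) (inr y) -> link (inr (w y)) (inr (f x)).
Proof. by move=> xy; left; apply: HalfLower. Qed.

(** Each middle vertex has the label of one end of its path: w y and g y the
    label (g y)', and f x the label f x. The edge (w y)' -- (f x)' then goes to
    the edge f x -- (g y)' of [link], so the labelling needs no case distinction
    on whether a vertex lies on a transversal. *)
Lemma link_idem : idempotents (brauer X) link.
Proof.
apply: brauerP => u v; split.
  pose h (q : pvertex X) : X + X := match q with
    | Top x => inl x | Bot x => inr x
    | Mid z => along w (inr \o g) (along g (inr \o g) (inl z) z) z end.
  have ho u1 : h (outer u1) = u1 by case: u1.
  have hw y : h (Mid (w y)) = inr (g y) by rewrite /= alongE.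
  have hg y : h (Mid (g y)) = inr (g y).
    by rewrite /= along_out ?alongE // => -[x _ /esym]; exact: gw.
  have hf x : h (Mid (f x)) = inl (f x).
    by rewrite /= !along_out // => -[y _ /esym]; [exact: fg|exact: fw].
  have hu u1 : h (upper (place u1)) = place u1 by case: u1.
  have hl u1 : h (lower (place u1)) = place u1 by case: u1.
  have sy q r : h q = h r \/ link (h q) (h r) -> h r = h q \/ link (h r) (h q).
    by case=> [->|/edge_sym]; [left|right].
  move=> uv; have := @mul_collapse link link link h _ _ u v uv.
  rewrite !ho => -[||uv_eq|//]; last by case: uv => /(_ uv_eq).
    suff hl1 u1 v1 : half_link u1 v1 -> h (upper u1) = h (upper v1) \/
        link (h (upper u1)) (h (upper v1)) by move=> u1 v1 [/hl1|/hl1/sy].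
    case=> [p q pq|y|x y xy]; right.
    - by rewrite !hu; apply: link_place.
    - exact: link_upper.
    - rewrite [upper _]/= [X in h X]/= hw hf.
      exact/edge_sym/(@link_place (inl x) (inr y)).
  suff hl1 u1 v1 : half_link u1 v1 -> h (lower u1) = h (lower v1) \/
      link (h (lower u1)) (h (lower v1)) by move=> u1 v1 [/hl1|/hl1/sy].
  case=> [p q pq|y|x y xy].
  - by right; rewrite !hl; apply: link_place.
  - by left; rewrite /lower hw hg.
  - by right; apply: link_lower.
have path x y : c (inl x) (inr y) -> pconn link link (Top (f x)) (Bot (g y)).
  move=> xy; have lxy := link_place xy.
  apply: rt_trans (pconn_upper _ lxy) _.
  apply: rt_trans (pconn_lower _ (link_upper y)) _.
  apply: rt_trans (pconn_upper _ (link_lower xy)) _.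
  exact: (pconn_lower _ lxy).
suff hh u1 v1 : half_link u1 v1 -> pconn link link (outer u1) (outer v1).
  move=> uv; split; first by move=> e; move: uv; rewrite e; apply: edge_irr.
  by case: uv => /hh // /pconn_sym.
case=> [p q pq|y|x y xy].
- case: p q pq => [x|x] [y|y] pq /=.
  + exact: (pconn_upper _ (link_place pq)).
  + exact: path.
  + by apply: pconn_sym; apply: path; apply: edge_sym.
  + exact: (pconn_lower _ (link_place pq)).
- exact: (pconn_upper _ (link_upper y)).
- exact: (pconn_lower _ (link_lower xy)).
Qed.

Lemma sends_link a : sends a f -> (forall x, c (inl x) (inr x)) ->
  sends (a * link) g.
Proof.
move=> af c1 x; apply: (@mul_path _ _ _ _ (Mid (f x))) => //.
  exact: (pconn_upper _ (af x)).
exact: (pconn_lower _ (link_place (c1 x))).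
Qed.

(** Where a meets [link], the vertices off the range of f carry only lower hooks
    of a and the edges g y -- w y, so no path through them comes out; likewise
    where [link] meets b, off the range of g. Only the copy of c in [link] is
    seen from outside. *)
Lemma sandwich_link a b : sends a f -> sends (flip b) g -> a * link * b = c.
Proof.
move=> af bg; apply: brauerP => u v; split.
  pose h1 (q : pvertex X) : X + X := match q with
    | Top x => inl x | Mid z => along f inl u z | Bot z => along g inr u z end.
  pose h2 (q : pvertex X) : X + X := match q with
    | Top x => inl x | Mid z => along g inr u z | Bot y => inr y end.
  have ho u1 : h2 (outer u1) = u1 by case: u1.
  have h12 u1 : h2 (upper u1) = h1 (outer u1) by case: u1.
  have hp u1 : h1 (lower (place u1)) = u1 by case: u1 => x; rewrite /= alongE.
  move=> uv; have := @mul_collapse (a * link) b c h2 _ _ u v uv.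
  rewrite !ho => -[||uv_eq|//]; last by case: uv => /(_ uv_eq).
    move=> u1 v1; rewrite !h12; apply: mul_collapse => {}u1 {}v1.
      move=> /(sends_edge af).
      by case=> [[x [-> ->]]|[x [-> ->]]|[y [z [-> -> ny nz]]]] /=;
        left; rewrite ?alongE ?along_out.
    case=> -[p q pq|y|x y xy].
    - by right; rewrite !hp.
    - left; rewrite /= !along_out // => -[z _]; [exact: fw|exact: fg].
    - left; rewrite /= !along_out // => -[z _]; [move/esym; exact: fg|exact: gw].
    - by right; rewrite !hp; apply: edge_sym.
    - left; rewrite /= !along_out // => -[z _]; [exact: fg|exact: fw].
    - left; rewrite /= !along_out // => -[z _]; [exact: gw|move/esym; exact: fg].
  move=> u1 v1 uv1; have : flip b (swap u1) (swap v1) by rewrite /= !swapK.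
  move=> /(sends_edge bg) {}uv1; rewrite -(swapK u1) -(swapK v1).
  by case: uv1 => [[x [-> ->]]|[x [-> ->]]|[y [z [-> -> ny nz]]]] /=;
    left; rewrite ?alongE ?along_out.
pose phi (u1 : X + X) : X + X :=
  match u1 with inl x => inl x | inr y => inr (g y) end.
have phi_inj : injective phi by move=> [x|x] [y|y] //= -[] // /ginj ->.
have al u1 : pconn a link (outer (phi u1)) (lower (place u1)).
  by case: u1 => x; [exact: (pconn_upper _ (af x))|exact: rt_refl].
have bl u1 : pconn (a * link) b (outer u1) (upper (phi u1)).
  case: u1 => x; first exact: rt_refl.
  exact: (@pconn_lower _ b (inr x) (inl (g x)) (bg x)).
move=> uv; have ne : u <> v by move=> e; move: uv; rewrite e; apply: edge_irr.
apply: (mul_path ne (bl u)); apply: rt_trans _ (pconn_sym (bl v)).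
apply: pconn_upper; apply: (mul_path _ (al u)); first by move/phi_inj.
exact: rt_trans (pconn_lower _ (link_place uv)) (pconn_sym (al v)).
Qed.

End Link.

(** * Sizes of defects and codefects *)

Lemma mul_transversal a b x y z :
  a (inl x) (inr z) -> b (inl z) (inr y) -> (a * b)%g (inl x) (inr y).
Proof.
move=> xz zy; apply: (@mul_path _ _ _ _ (Mid z)) => //.
  exact: (pconn_upper _ xz).
exact: (pconn_lower _ zy).
Qed.

(** A point of [Codom b] outside [Codom (a * b)] is joined by b to a point outside
    [Codom a], so codef (a * b) <= codef a + codef b. *)
Lemma Codefect_mul a b : infinite_set [set: X] ->
  [set: X] #<= Codefect (a * b) ->
  [set: X] #<= Codefect a \/ [set: X] #<= Codefect b.
Proof.
move=> infX big.
pose L := [set y | exists2 z, Codefect a z & b (inl z) (inr y)].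
have sub : Codefect (a * b) `<=` L `|` Codefect b.
  move=> y ny; have [[z zy]|] := pselect (Codom b y); last by right.
  left; exists z => // -[x xz]; apply: ny.
  by exists x; apply: mul_transversal xz zy.
have [bigL|] := card_le_setU infX (card_le_trans big (subset_card_le sub)).
  left; apply: card_le_trans bigL _.
  have /choice[f fP] y : exists z, L y -> Codefect a z /\ b (inl z) (inr y).
    by have [[z az zy]|] := pselect (L y); [exists z|exists y].
  apply: (@card_le_fun _ _ _ _ f) => [y /fP[]//|y1 y2 /fP[_ h1] /fP[_ h2] e].
  by rewrite e in h1; have [] := edge_deg h1 h2.
by right.
Qed.

(** The transversals of e map [Dom e] minus [Codom e] into the complement of
    [Dom e]: if x -- y' and y -- z' are transversals then so is x -- z', because
    e * e = e; hence z = y and x = y, and x is in [Codom e]. *)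
Lemma Codefect_idem e : infinite_set [set: X] -> e * e = e ->
  [set: X] #<= Codefect e -> [set: X] #<= Defect e.
Proof.
move=> infX ee big.
have sub : Codefect e `<=` Defect e `|` (Dom e `&` Codefect e).
  by move=> x nx; have [|] := pselect (Dom e x); [right|left].
have [//|bigD] := card_le_setU infX (card_le_trans big (subset_card_le sub)).
apply: card_le_trans bigD _.
have /choice[f fP] x : exists y, Dom e x -> e (inl x) (inr y).
  by have [[y xy]|] := pselect (Dom e x); [exists y|exists x].
apply: (@card_le_fun _ _ _ _ f) =>
    [x [/fP xy nx] [z yz]|x1 x2 [/fP h1 _] [/fP h2 _] efx].
  have : (e * e)%g (inl x) (inr z) by apply: mul_transversal xy yz.
  rewrite ee => xz; have [fz] := edge_deg xy xz.
  rewrite -fz in yz; have [xf] := edge_deg (edge_sym xy) (edge_sym yz).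
  by apply: nx; exists x; rewrite {2}xf.
by rewrite efx in h1; have [] := edge_deg (edge_sym h1) (edge_sym h2).
Qed.

(** A point z of [Codom p] outside [Dom e] must still be left by the path that
    comes down to it, hence lies on an upper hook z -- z2 of e; and z2 is not in
    [Codom p], for otherwise the path would climb back up. So these z inject into
    the codefect of p. *)
Lemma Defect_right_factor p e : infinite_set [set: X] -> Dom (p * e) = setT ->
  [set: X] #<= Defect e -> [set: X] #<= Codefect p.
Proof.
move=> infX DT big.
have sub : Defect e `<=` Codefect p `|` (Codom p `&` Defect e).
  by move=> x nx; have [|] := pselect (Codom p x); [right|left].
have [//|bigD] := card_le_setU infX (card_le_trans big (subset_card_le sub)).
apply: card_le_trans bigD _.
have hook z : (Codom p `&` Defect e) z ->
    exists z2, Codefect p z2 /\ e (inl z) (inl z2).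
  case=> -[x xz] nz; have [y xy] : Dom (p * e) x by rewrite DT.
  have [z2 zz2] : exists z2, e (inl z) (inl z2).
    apply: contrapT => n2; pose P (q : pvertex X) := q = Top x \/ q = Mid z.
    have : P (outer (inr y)); last by case.
    apply: (@mul_closed p e P _ _ _ _ xy); last by left.
      move=> u v uv [] eu.
        have eu' : u = inl x by case: u eu {uv} => t //= [->].
        by rewrite eu' in uv; rewrite (edge_deg uv xz); right.
      have eu' : u = inr z by case: u eu {uv} => t //= [->].
      by rewrite eu' in uv; rewrite (edge_deg uv (edge_sym xz)); left.
    move=> u [t|t] uv [] eu; case: u eu uv => // t' [-> uv].
      by case: n2; exists t.
    by case: nz; exists t.
  exists z2; split=> // -[x2 xz2].
  have : (p * e)%g (inl x) (inl x2).
    apply: (@mul_path _ _ _ _ (Mid z)).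
    - move=> [ex]; rewrite -ex in xz2; have [ez] := edge_deg xz xz2.
      by rewrite -ez in zz2; apply: edge_irr zz2.
    - exact: (pconn_upper _ xz).
    - exact: rt_trans (pconn_lower _ zz2) (pconn_upper _ (edge_sym xz2)).
  by move=> /(edge_deg xy).
have /choice[f fP] z : exists z2, (Codom p `&` Defect e) z ->
    Codefect p z2 /\ e (inl z) (inl z2).
  by have [/hook[z2]|] := pselect ((Codom p `&` Defect e) z); [exists z2|exists z].
apply: (@card_le_fun _ _ _ _ f) => [z /fP[]//|z1 z2 /fP[_ h1] /fP[_ h2] ez].
by rewrite ez in h1; have [] := edge_deg (edge_sym h1) (edge_sym h2).
Qed.

Section Injection.
Variables (f : X -> X) (finj : injective f).

Definition inject_edge u v :=
  (exists x, u = inl x /\ v = inr (f x)) \/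
  (exists x, v = inl x /\ u = inr (f x)).

Lemma inject_sym u v : inject_edge u v -> inject_edge v u.
Proof. by case; [right|left]. Qed.

Lemma inject_irr u : ~ inject_edge u u.
Proof. by case=> -[x [->]]. Qed.

Lemma inject_deg u : is_subset1 [set v | inject_edge u v].
Proof.
move=> v1 v2 [] [x [e1 e2]] [] [y [e3 e4]]; subst => //.
  by case: e3 => ->.
by case: e4 => /finj ->.
Qed.

Definition inject : brauer X := Brauer inject_sym inject_irr inject_deg.

Lemma sends_inject : sends inject f.
Proof. by move=> x; left; exists x. Qed.

Lemma Codom_inject : Codom inject = range f.
Proof.
apply/seteqP; split=> y; last by case=> x _ <-; exists x; apply: sends_inject.
by case=> x [] [z [e1 e2]] //; case: e2 => ->; exists z.
Qed.

End Injection.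

End Brauer.

(** * Generating sets and one-sided units *)

Section Generation.
Local Open Scope group_scope.

Lemma gen_subsemigroup (S : semigroupType) (U : set S) : subsemigroup (gen U).
Proof.
move=> x y Ux Uy A A_; case: (A_) => sA _.
by apply: sA; [exact: Ux|exact: Uy].
Qed.

Lemma sub_gen (S : semigroupType) (U : set S) : U `<=` gen U.
Proof. exact: sub_smallest. Qed.

(** Nesting [idem_gen] inside [gen] makes no difference to induction: only the
    idempotents themselves and U need checking. *)
Lemma gen_ind (S : semigroupType) (U P : set S) :
  subsemigroup P -> idempotents S `<=` P -> U `<=` P ->
  gen (idem_gen S `|` U) = setT -> forall x, P x.
Proof.
move=> sP EP UP G x; have : gen (idem_gen S `|` U) x by rewrite G.
apply: smallest_sub => // z [|/UP//]; exact: smallest_sub.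
Qed.

Variable M : monoidType.

Lemma idempotent_right_unit (e : M) : e * e = e -> right_units M e -> e = 1.
Proof. by move=> ee [b eb]; rewrite -eb -{2}ee -mulgA eb mulg1. Qed.

Lemma idempotent_left_unit (e : M) : e * e = e -> left_units M e -> e = 1.
Proof. by move=> ee [b be]; rewrite -be -{2}ee mulgA be mul1g. Qed.

(** The elements whose being a left unit makes them units form a subsemigroup
    containing the idempotents: a left unit x * y makes y a left unit, hence a
    unit, and then x = (x * y) * y^-1 is a left unit too. *)
Lemma strict_left_unit_generator (U : set M) :
  gen (idem_gen M `|` U) = setT ->
  (exists x, left_units M x /\ ~ right_units M x) ->
  exists2 z, U z & left_units M z /\ ~ right_units M z.
Proof.
move=> G [x [lx nrx]]; apply: contrapT => nU; apply: nrx.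
pose P := [set z : M | left_units M z -> right_units M z].
apply: (@gen_ind _ U P) => // [{lx}x y Px Py [a axy]|e ee le|z Uz lz].
- rewrite mulgA in axy; have [b yb] : right_units M y by apply: Py; exists (a * x).
  have eb : a * x = b by rewrite -[LHS]mulg1 -yb mulgA axy mul1g.
  have [d xd] : right_units M x by apply: Px; exists (y * a); rewrite -mulgA eb.
  by exists (b * d); rewrite -mulgA (mulgA y) yb mul1g.
- by exists 1; rewrite (idempotent_left_unit ee le) mulg1.
- by apply: contrapT => nz; apply: nU; exists z.
Qed.

Lemma strict_right_unit_generator (U : set M) :
  gen (idem_gen M `|` U) = setT ->
  (exists x, right_units M x /\ ~ left_units M x) ->
  exists2 z, U z & right_units M z /\ ~ left_units M z.
Proof.
move=> G [x [rx nlx]]; apply: contrapT => nU; apply: nlx.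
pose P := [set z : M | right_units M z -> left_units M z].
apply: (@gen_ind _ U P) => // [{rx}x y Px Py [a xya]|e ee re|z Uz rz].
- rewrite -mulgA in xya; have [b bx] : left_units M x by apply: Px; exists (y * a).
  have eb : y * a = b by rewrite -[LHS]mul1g -bx -mulgA xya mulg1.
  have [d dy] : left_units M y by apply: Py; exists (a * x); rewrite mulgA eb.
  by exists (d * b); rewrite -mulgA (mulgA b) bx mul1g.
- by exists 1; rewrite (idempotent_right_unit ee re) mulg1.
- by apply: contrapT => nz; apply: nU; exists z.
Qed.

End Generation.

(** * Generating pairs *)

Section Main.
Local Open Scope group_scope.
Variable X : Type.
Hypothesis infX : infinite_set [set: X].
Implicit Types (a b c e p : brauer X) (u v : X + X) (f g w : X -> X).

(** The move that replaces f by g, multiplying by the linking idempotent of the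
    identity; the injection w records that there is room left inside C. *)
Lemma sends_into (A : set (brauer X)) a f (C : set X) :
  subsemigroup A -> idempotents (brauer X) `<=` A -> A a -> sends a f ->
  [set: X] #<= C -> (forall x, ~ C (f x)) ->
  exists a' g w, [/\ A a', sends a' g, injective w,
    forall x, C (g x) /\ C (w x) & forall x y, g x <> w y].
Proof.
move=> sA EA Aa af /(two_copies infX)[g [w [ginj winj gC wC gw]]] nC.
have fg x y : f x <> g y by move=> e; apply: (nC x); rewrite e.
have fw x y : f x <> w y by move=> e; apply: (nC x); rewrite e.
have finj := sends_inj af.
exists (a * link 1 finj ginj winj fg fw gw), g, w; split=> //.
  by apply: sA => //; apply: EA; apply: link_idem.
by apply: sends_link.
Qed.

Lemma generate_all (A : set (brauer X)) a b :
  subsemigroup A -> idempotents (brauer X) `<=` A -> A a -> A b ->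
  Dom a = setT -> Codom b = setT ->
  [set: X] #<= Codefect a -> [set: X] #<= Defect b -> forall c, A c.
Proof.
move=> sA EA Aa Ab /DomTP[f af]; rewrite -Dom_flip => /DomTP[g bg] bigA bigB c.
have nDb y : ~ Defect b (g y) by apply; exists y; apply: edge_sym (bg y).
have nCa x : ~ Codefect a (f x) by apply; exists x; apply: af.
suff [a' [f' [w [Aa' af' winj fwD fw]]]] : exists a' f' w,
    [/\ A a', sends a' f', injective w,
    forall x, Defect b (f' x) /\ Defect b (w x) & forall x y, f' x <> w y].
  have fg x y : f' x <> g y by move=> e; apply: (nDb y); rewrite -e; case: (fwD x).
  have gw x y : g x <> w y by move=> e; apply: (nDb x); rewrite e; case: (fwD y).
  have f'inj := sends_inj af'; have ginj := sends_inj bg.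
  rewrite -(sandwich_link c f'inj ginj winj fg fw gw af' bg).
  by apply: (sA) => //; apply: sA => //; apply: EA; apply: link_idem.
(* If |X| points avoid both ranges, one move suffices; otherwise a first move
   into the range of g makes room for a second one out of it. *)
have sub : Codefect a `<=` (Codefect a `&` Defect b) `|` (Codefect a `&` Dom b).
  by move=> z az; have [|] := pselect (Dom b z); [right|left].
have [big|big] := card_le_setU infX (card_le_trans bigA (subset_card_le sub)).
  have [|a' [h [w [Aa' ah winj hw ne]]]] := sends_into sA EA Aa af big.
    by move=> x [] /nCa.
  by exists a', h, w; split=> // x; have [[] ? ? []] := hw x.
have [|a' [h [w [Aa' ah _ hw _]]]] := sends_into sA EA Aa af big.
  by move=> x [] /nCa.
apply: (sends_into sA EA Aa' ah bigB) => x; have [[_ hx] _] := hw x; exact.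
Qed.

Lemma exists_big_right_unit :
  exists a, [/\ Dom a = setT, Codom a <> setT & [set: X] #<= Codefect a].
Proof.
have [f [w [finj winj _ _ fw]]] := two_copies infX (card_lexx [set: X]).
have big : [set: X] #<= Codefect (inject finj).
  rewrite /Codefect Codom_inject.
  apply: (@card_le_fun _ _ _ _ w) => [y _ [x _]|x y _ _]; first exact: fw.
  exact: winj.
exists (inject finj); split=> //.
  by apply/DomTP; exists f; apply: sends_inject.
by move=> CT; move: big; rewrite /Codefect CT setCT => /(set0_small infX).
Qed.

(** Membership in P says that right multiplication by z never leads from a right
    unit of small codefect to a right unit of large codefect; stated in this way
    it is closed under products, and p = 1 gives the contradiction. *)
Lemma big_Codefect a b : gen (idem_gen (brauer X) `|` [set a; b]) = setT ->
  Codom b = setT -> [set: X] #<= Codefect a.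
Proof.
move=> G bT; apply: contrapT => small_a.
pose P z := forall p, ~ ([set: X] #<= Codefect p) -> Dom (p * z) = setT ->
  ~ ([set: X] #<= Codefect (p * z)).
have small1 : ~ ([set: X] #<= Codefect (1 : brauer X)).
  have -> : Codefect (1 : brauer X) = set0; last exact: set0_small.
  by apply/seteqP; split=> // x; apply; exists x.
have [t [tD _ tX]] := exists_big_right_unit.
suff /(_ t 1 small1) : forall z, P z by rewrite mul1g; apply.
apply: (gen_ind _ _ _ G).
- move=> x y Px Py p sp; rewrite mulgA => D; apply: Py => //; apply: Px => //.
  by apply/seteqP; split=> // z _; apply: (@sub_Dom_mul _ _ y); rewrite D.
- move=> e ee p sp D /(Codefect_mul infX)[//|/(Codefect_idem infX ee)].
  by move=> /(Defect_right_factor infX D).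
- move=> z [->|->] p sp D /(Codefect_mul infX)[]//.
  by rewrite /Codefect bT setCT => /(set0_small infX).
Qed.

Lemma gen_flip (U : set (brauer X)) : gen (idem_gen (brauer X) `|` U) = setT ->
  gen (idem_gen (brauer X) `|` @flip X @` U) = setT.
Proof.
move=> G; apply/seteqP; split=> // z _; rewrite -(flipK z).
pose P := [set t | gen (idem_gen (brauer X) `|` @flip X @` U) (flip t)].
apply: (@gen_ind _ U P) => // [x y Px Py|e ee|t Ut].
- by rewrite /P /= flipM; apply: gen_subsemigroup.
- by apply: sub_gen; left; apply: sub_gen; rewrite /idempotents /= -flipM ee.
- by apply: sub_gen; right; exists t.
Qed.

Lemma strict_generators (U : set (brauer X)) :
  gen (idem_gen (brauer X) `|` U) = setT ->
  exists a b, [/\ U a, U b, a <> b, Dom a = setT & Codom b = setT].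
Proof.
move=> G; have [t [tD tC _]] := exists_big_right_unit.
have [|a Ua [/right_unitsP aD al]] := strict_right_unit_generator G.
  by exists t; split; [apply/right_unitsP|move=> /left_unitsP].
have [|b Ub [/left_unitsP bC br]] := strict_left_unit_generator G.
  exists (flip t); rewrite left_unitsP right_unitsP Codom_flip Dom_flip; split=> //.
exists a, b; split=> // e; apply: al; rewrite e; exact/left_unitsP.
Qed.

Definition good_pair a b :=
  [/\ right_units (brauer X) a, left_units (brauer X) b,
  Codefect a #= Defect b & Defect b #= [set: X]].

Lemma good_pairP a b : good_pair a b <-> [/\ Dom a = setT, Codom b = setT,
  [set: X] #<= Codefect a & [set: X] #<= Defect b].
Proof.
rewrite /good_pair (propext (right_unitsP a)) (propext (left_unitsP b)).
split=> -[aD bC].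
  move=> ab bX; split=> //; last by rewrite (card_le_eqr bX) card_lexx.
  by rewrite (card_le_eqr ab) (card_le_eqr bX) card_lexx.
move=> aX bX.
have eqX (B : set X) : [set: X] #<= B -> B #= [set: X].
  by move=> h; rewrite card_eq_le h card_leT.
split=> //; last exact: eqX.
by apply: card_eq_trans (eqX _ aX) _; rewrite card_eq_sym; apply: eqX.
Qed.

Lemma generating_pair a b :
  gen (idem_gen (brauer X) `|` [set a; b]) = setT <->
  good_pair a b \/ good_pair b a.
Proof.
have fwd a' b' : good_pair a' b' ->
    gen (idem_gen (brauer X) `|` [set a'; b']) = setT.
  move=> /good_pairP[aD bC aX bX]; apply/seteqP; split=> // c _.
  apply: (generate_all _ _ _ _ aD bC aX bX).
  - exact: gen_subsemigroup.
  - by move=> e ee; apply: sub_gen; left; apply: sub_gen.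
  - by apply: sub_gen; right; left.
  - by apply: sub_gen; right; right.
split; last by case=> /fwd //; rewrite setUC [[set b; a]]setUC setUC.
move=> G.
have bwd a' b' : gen (idem_gen (brauer X) `|` [set a'; b']) = setT ->
    Dom a' = setT -> Codom b' = setT -> good_pair a' b'.
  move=> G' aD bC; apply/good_pairP; split=> //; first exact: big_Codefect G' bC.
  have /gen_flip := G'.
  rewrite image_setU !image_set1 setUC [[set _] `|` _]setUC setUC.
  by move=> /big_Codefect; rewrite Codom_flip /Codefect Codom_flip; apply.
have [a' [b' [[->|->] [->|->] ne aD bC]]] := strict_generators G => //.
- by left; apply: bwd.
- by right; apply: bwd => //; rewrite [[set b; a]]setUC.
Qed.

End Main.

Theorem theorem5p12 (X : Type) (infX : infinite_set [set: X]) :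
  relrank_eq (idem_gen (brauer X)) `I_2 /\
  (forall a b : brauer X,
     gen (idem_gen (brauer X) `|` [set a; b]) = setT <->
     let good (g h : brauer X) :=
       [/\ right_units (brauer X) g,
           left_units (brauer X) h,
           Codefect g #= Defect h &
           Defect h #= [set: X]] in
     good a b \/ good b a).
Proof.
split; last exact: generating_pair.
have two T (U : set T) a b : U a -> U b -> a <> b -> `I_2 #<= U.
  move=> Ua Ub ab.
  apply: (@card_le_fun _ _ _ _ (fun n => if n is 0 then a else b)).
    by case.
  by move=> [|[|n]] [|[|m]] //= _ _ /esym.
split=> [|U /(strict_generators infX)[a [b [Ua Ub ab _ _]]]]; last first.
  exact: two Ua Ub ab.
have [a [aD aC aX]] := exists_big_right_unit infX.
exists [set a; flip a]; split.
  apply/(generating_pair infX); left; apply/good_pairP.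
  by rewrite Codom_flip /Defect Dom_flip.
have ne : a <> flip a by move=> e; apply: aC; rewrite e Codom_flip.
rewrite card_eq_le; apply/andP; split; last first.
  by apply: (two _ _ a (flip a)); [left|right|].
apply: (@card_le_fun _ _ _ _ (fun z => if pselect (z = a) then 0%N else 1%N)).
  by move=> z _; case: pselect.
by move=> x y [->|->] [->|->] //; do 2?[case: pselect => //].
Qed.
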